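(* For every integer $N\ge1$, $$\lim_{s\to1}\left[\zeta_N(s)-\frac{N}{s-1}\right]=\log(N!)-N\frac{\Gamma'(N)}{\Gamma(N)}.$$
   Context: For an integer $M\ge0$, $T_M(x)=\sum_{k=0}^{M}\frac{x^k}{k!}$. For $N\ge1$, $\zeta_N(s)=\frac{1}{\Gamma(s+N-1)}\int_0^\infty \frac{x^{s+N-2}}{e^x-T_{N-1}(x)}\,dx$ for $\Re(s)>1$, and $\zeta_N$ also denotes its meromorphic continuation to $\mathbb{C}$. *)

(* Defs.v *)
From Stdlib Require Export Reals Factorial.
From Coquelicot Require Export Coquelicot.

Open Scope R_scope.

Definition Cexp (z : C) : C :=
  (exp (Re z) * cos (Im z), exp (Re z) * sin (Im z)).

(* [Rcpow x z] is the principal value of x^z; meaningful for x > 0 only. *)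
Definition Rcpow (x : R) (z : C) : C := Cexp (z * RtoC (ln x))%C.

(* Improper at both ends: the limit of the proper integrals over [a, b]
   as a -> 0+ and b -> +oo, so values of f at x <= 0 are irrelevant. *)
Definition CInt_0_oo (f : R -> C) : C :=
  @RInt_gen C_R_CompleteNormedModule f (at_right 0) (Rbar_locally p_infty).

(* Euler's integral, hence the Gamma function on Re z > 0 only. *)
Definition Gamma (z : C) : C :=
  CInt_0_oo (fun x => Rcpow x (z - 1) * RtoC (exp (- x)))%C.

Definition T (M : nat) (x : R) : R :=
  sum_n (fun k => x ^ k / INR (fact k)) M.

(* For N >= 1 and Re s > 1 the argument s + N - 1 of Gamma has positive
   real part. *)
Definition zeta_int (N : nat) (s : C) : C :=
  (/ Gamma (s + RtoC (INR N) - 1) *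
   CInt_0_oo (fun x => Rcpow x (s + RtoC (INR N) - 2) /
                       RtoC (exp x - T (N - 1) x)))%C.

Definition analytic_at (f : C -> C) (p : C) : Prop :=
  exists a : nat -> C,
    locally p (fun s : C =>
      @is_pseries C_AbsRing C_NormedModule a (s - p)%C (f s)).

(* A pole of order m is allowed at p, and the value f p is immaterial:
   replacing n by n + 1 makes the product vanish at p. *)
Definition meromorphic_at (f : C -> C) (p : C) : Prop :=
  exists n : nat, analytic_at (fun s => (s - p) ^ n * f s)%C p.

(* Z is a meromorphic function on the whole plane extending [zeta_int N];
   it is determined by this up to its values at isolated points. *)
Definition is_zeta (N : nat) (Z : C -> C) : Prop :=
  (forall p : C, meromorphic_at Z p) /\
  (forall s : C, 1 < Re s -> Z s = zeta_int N s).

(* Main.v *)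
(* Write N = m + 1 and G(x) = 1 - e^-x T_m(x), so that G' = e^-x x^m / m! and
   x^m / (e^x - T_m(x)) = m! G'/G.  Near 0, G(x) behaves like x^N / N!, so we
   compare x^t with (N! G)^(t/N).  The integral of (N! G)^(t/N) G'/G over
   (0, oo) is exactly (N!)^(t/N) N/t, and the error made is O(t).  Hence, for
   real t -> 0+,
     Gamma(N + t) zeta_N(1 + t) = m! ((N!)^(t/N) N/t + O(t)),
   and a first order expansion of Gamma at N gives the limit along the ray
   s = 1 + t.  As zeta_N is meromorphic at 1, a finite limit of
   zeta_N(s) - N/(s - 1) along this ray is the limit on a punctured
   neighbourhood of 1.  Only real arguments of Gamma occur: [C_lim], hence
   [C_derive], takes limits along the real direction. *)
Require Import Defs.
From Stdlib Require Import Lra Lia.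
Open Scope R_scope.

(** * Improper integrals over the positive reals *)

Definition is_int_0_oo (f : R -> R) (l : R) : Prop :=
  is_RInt_gen f (at_right 0) (Rbar_locally p_infty) l.

(** Cutting both filters at 1 forces a < 1 < b, so any property of the endpoints may be checked
    under 0 < a < b alone. *)
Lemma filter_prod_0_oo (P : R * R -> Prop) :
  (forall a b, 0 < a -> a < b -> P (a, b)) ->
  filter_prod (at_right 0) (Rbar_locally p_infty) P.
Proof.
  intros H.
  apply Filter_prod with (fun a => 0 < a < 1) (fun b => 1 < b).
  - exists (mkposreal 1 Rlt_0_1); intros y Hy Hy0.
    unfold ball in Hy; simpl in Hy; unfold AbsRing_ball, abs, minus, plus, opp in Hy;
      simpl in Hy.
    apply Rabs_def2 in Hy; lra.
  - exists 1; tauto.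
  - intros a b Ha Hb; apply H; lra.
Qed.

Lemma is_int_0_oo_ext (f g : R -> R) (l : R) :
  (forall x, 0 < x -> f x = g x) -> is_int_0_oo f l -> is_int_0_oo g l.
Proof.
  intros Hfg; apply is_RInt_gen_ext, filter_prod_0_oo.
  intros a b Ha Hb x; simpl; rewrite Rmin_left, Rmax_right by lra.
  intros Hx; apply Hfg; lra.
Qed.

Lemma is_int_0_oo_antiderivative (F f : R -> R) (la lb : R) :
  (forall x, 0 < x -> is_derive F x (f x)) ->
  (forall x, 0 < x -> continuous f x) ->
  filterlim F (at_right 0) (locally la) ->
  filterlim F (Rbar_locally p_infty) (locally lb) ->
  is_int_0_oo f (lb - la).
Proof.
  intros HF Hf Ha Hb.
  apply is_int_0_oo_ext with (Derive F).
  { intros x Hx; apply is_derive_unique, HF, Hx. }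
  apply is_RInt_gen_Derive; try assumption; apply filter_prod_0_oo;
    intros a b Ha0 Hab x; simpl; rewrite Rmin_left, Rmax_right by lra; intros Hx.
  - exists (f x); apply HF; lra.
  - apply continuous_ext_loc with f; [|apply Hf; lra].
    exists (mkposreal x ltac:(lra)); intros y Hy; symmetry.
    apply is_derive_unique, HF.
    unfold ball in Hy; simpl in Hy; unfold AbsRing_ball, abs, minus, plus, opp in Hy;
      simpl in Hy.
    apply Rabs_def2 in Hy; lra.
Qed.

Lemma ex_RInt_pos (f : R -> R) (a b : R) :
  (forall x, 0 < x -> continuous f x) -> 0 < a -> 0 < b -> ex_RInt f a b.
Proof.
  intros Hf Ha Hb; apply (ex_RInt_continuous (V := R_CompleteNormedModule)).
  intros z Hz; apply Hf, Rlt_le_trans with (Rmin a b); [|apply Hz].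
  now apply Rmin_glb_lt.
Qed.

(** The absolute value on the right makes the bound independent of the order of the endpoints; the
    Cauchy criterion below compares endpoints in either order. *)
Lemma RInt_dominated (f g : R -> R) (a b : R) :
  (forall x, 0 < x -> continuous f x) ->
  (forall x, 0 < x -> continuous g x) ->
  (forall x, 0 < x -> Rabs (f x) <= g x) ->
  0 < a -> 0 < b -> Rabs (RInt f a b) <= Rabs (RInt g a b).
Proof.
  intros Hf Hg Hfg.
  assert (H : forall a b, 0 < a -> a <= b -> Rabs (RInt f a b) <= Rabs (RInt g a b)).
  { clear a b; intros a b Ha Hab.
    apply Rle_trans with (RInt g a b); [|apply Rle_abs].
    apply (norm_RInt_le f g a b); try assumption.
    - intros x Hx; apply Hfg; lra.
    - apply (RInt_correct (V := R_CompleteNormedModule)), ex_RInt_pos; auto; lra.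
    - apply (RInt_correct (V := R_CompleteNormedModule)), ex_RInt_pos; auto; lra. }
  intros Ha Hb; destruct (Rle_lt_dec a b); [now apply H|].
  rewrite <- (opp_RInt_swap f), <- (opp_RInt_swap g);
    try (apply ex_RInt_pos; assumption).
  unfold opp; simpl; rewrite !Rabs_Ropp; apply H; lra.
Qed.

Lemma RInt_Chasles_minus (f : R -> R) (a b c d : R) :
  (forall x, 0 < x -> continuous f x) -> 0 < a -> 0 < b -> 0 < c -> 0 < d ->
  RInt f a b - RInt f c d = RInt f a c + RInt f d b.
Proof.
  intros Hf Ha Hb Hc Hd.
  rewrite <- (RInt_Chasles f a c b), <- (RInt_Chasles f c d b);
    try (apply ex_RInt_pos; assumption).
  unfold plus; simpl; ring.
Qed.

(** Comparison test: the Cauchy criterion passes from the proper integrals of g to those of f. It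
    provides the existence of every error integral used later. *)
Lemma is_int_0_oo_dominated (f g : R -> R) (lg : R) :
  (forall x, 0 < x -> continuous f x) ->
  (forall x, 0 < x -> continuous g x) ->
  (forall x, 0 < x -> Rabs (f x) <= g x) ->
  is_int_0_oo g lg ->
  exists lf, is_int_0_oo f lf /\ Rabs lf <= lg.
Proof.
  intros Hf Hg Hfg Ig.
  assert (Hex : exists lf, is_int_0_oo f lf).
  { assert (Hfun : forall h : R -> R, (forall x, 0 < x -> continuous h x) ->
      filter_prod (at_right 0) (Rbar_locally p_infty) (fun ab : R * R =>
        (exists y, is_RInt h (fst ab) (snd ab) y) /\
        (forall y1 y2, is_RInt h (fst ab) (snd ab) y1 ->
           is_RInt h (fst ab) (snd ab) y2 -> y1 = y2))).
    { intros h Hh; apply filter_prod_0_oo; intros a b Ha Hb; simpl; split.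
      - apply (ex_RInt_pos h); auto; lra.
      - intros y1 y2 H1 H2.
        rewrite <- (is_RInt_unique _ _ _ _ H1); exact (is_RInt_unique _ _ _ _ H2). }
    apply (filterlimi_locally_cauchy (U := R_CompleteSpace)); [now apply Hfun|].
    intros eps.
    destruct (proj2 (filterlimi_locally_cauchy (U := R_CompleteSpace) _ (Hfun g Hg))
      (ex_intro _ lg Ig) (mkposreal (eps / 2) (is_pos_div_2 eps))) as [P [HP HPP]].
    pose proof (filter_and _ _ HP (filter_prod_0_oo (fun ab => 0 < fst ab /\ 0 < snd ab)
      ltac:(simpl; intros; lra))) as HQ.
    destruct HQ as [Q1 Q2 HQ1 HQ2 HQ].
    exists (fun ab => Q1 (fst ab) /\ Q2 (snd ab)); split.
    { now apply Filter_prod with Q1 Q2. }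
    intros [a b] [a' b'] [Ha Hb] [Ha' Hb'] u v Hu Hv; simpl in *.
    apply (is_RInt_unique (V := R_CompleteNormedModule)) in Hu, Hv; subst u v.
    destruct (HQ _ _ Ha Hb) as [H1 [Pa Pb]]; destruct (HQ _ _ Ha' Hb') as [H2 [Pa' Pb']];
    destruct (HQ _ _ Ha' Hb) as [H3 _]; simpl in Pa, Pb, Pa', Pb'.
    assert (G : forall x y x' y', 0 < x -> 0 < y -> 0 < x' -> 0 < y' ->
      P (x, y) -> P (x', y') -> Rabs (RInt g x y - RInt g x' y') < eps / 2).
    { intros x y x' y' Hx Hy Hx' Hy' Hxy Hxy'.
      apply (HPP (x', y') (x, y)); auto;
        apply (RInt_correct (V := R_CompleteNormedModule)), ex_RInt_pos; auto. }
    (* The difference splits into the end pieces from a' to a and from b to b'. For g, each piece is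
       the difference of two integrals sharing an endpoint, with (a', b) as the intermediate pair,
       so each costs less than eps / 2. *)
    change (Rabs (RInt f a' b' - RInt f a b) < eps).
    rewrite RInt_Chasles_minus by assumption.
    eapply Rle_lt_trans; [apply Rabs_triang|].
    pose proof (RInt_dominated f g a' a Hf Hg Hfg Pa' Pa).
    pose proof (RInt_dominated f g b b' Hf Hg Hfg Pb Pb').
    pose proof (G a' b a b Pa' Pb Pa Pb H3 H1) as G1.
    pose proof (G a' b' a' b Pa' Pb' Pa' Pb H2 H3) as G2.
    rewrite RInt_Chasles_minus in G1, G2 by assumption.
    rewrite (RInt_point b g) in G1; rewrite (RInt_point a' g) in G2.
    unfold zero in G1, G2; simpl in G1, G2.
    rewrite Rplus_0_r in G1; rewrite Rplus_0_l in G2; lra. }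
  destruct Hex as [lf Hlf]; exists lf; split; [assumption|].
  apply (RInt_gen_norm (V := R_CompleteNormedModule) (Fa := at_right 0)
    (Fb := Rbar_locally p_infty) f g lf lg); try assumption; apply filter_prod_0_oo;
    simpl; intros; [lra|].
  apply Hfg; lra.
Qed.

(* Of order x^(-1/2) at 0 and x^(-3/2) at +oo, with an elementary antiderivative. *)
Definition weight (x : R) : R := / (sqrt x * (1 + sqrt x) ^ 2).

Lemma continuous_weight (x : R) : 0 < x -> continuous weight x.
Proof.
  intros Hx; pose proof (sqrt_lt_R0 x Hx).
  apply (ex_derive_continuous (V := R_NormedModule)).
  unfold weight; auto_derive; repeat split; try lra.
  apply Rgt_not_eq; nra.
Qed.

Lemma is_int_0_oo_weight : is_int_0_oo weight 2.
Proof.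
  replace 2 with (2 - 0) by ring.
  apply is_int_0_oo_antiderivative with (fun x => 2 - 2 / (1 + sqrt x)).
  - intros x Hx; pose proof (sqrt_lt_R0 x Hx).
    unfold weight; auto_derive; [repeat split; lra|].
    field; lra.
  - exact continuous_weight.
  (* As [sqrt] is 0 on negative reals, the antiderivative is continuous at 0 from both sides, and
     its limit at 0+ is its value there. *)
  - eapply filterlim_filter_le_1; [apply filter_le_within|].
    replace (locally 0) with (locally (2 - 2 / (1 + sqrt 0))) at 2
      by (f_equal; rewrite sqrt_0; field).
    apply (continuous_minus (V := R_NormedModule) (fun _ => 2) (fun x => 2 / (1 + sqrt x)));
      [apply continuous_const|].
    apply (continuous_scal_r (V := R_NormedModule) 2 (fun x => / (1 + sqrt x))).
    apply continuous_Rinv_comp; [|rewrite sqrt_0; lra].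
    apply (continuous_plus (V := R_NormedModule)); [apply continuous_const|].
    apply continuous_sqrt.
  - change (is_lim (fun x => 2 - 2 / (1 + sqrt x)) p_infty 2).
    evar_last.
    + eapply is_lim_minus; [apply is_lim_const| |].
      * eapply is_lim_div; [apply is_lim_const| | |].
        -- eapply is_lim_plus; [apply is_lim_const|apply is_lim_sqrt_p, is_lim_id|reflexivity].
        -- discriminate.
        -- reflexivity.
      * reflexivity.
    + simpl; f_equal; ring.
Qed.

(** * The truncated exponential *)

(** The exponential is the larger of sqrt x and 1 / sqrt x. With y = sqrt x, the case y <= 1 uses h
    <= A and 1 + y <= 2; the case y > 1 uses x^2 h <= A and 1 + y <= 2 y. Both give the factor 4. *)
Lemma log_exp_weight (A h x : R) :
  0 < x -> 0 <= h -> h <= A -> x ^ 2 * h <= A ->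
  h * exp (Rabs (ln x) / 2) <= 4 * A * weight x.
Proof.
  intros Hx H0 HA Hx2.
  pose proof (sqrt_lt_R0 x Hx) as Hy; pose proof (sqrt_sqrt x (Rlt_le _ _ Hx)) as Hyy.
  unfold weight; set (y := sqrt x) in *.
  assert (Hln : ln x = 2 * ln y).
  { rewrite <- Hyy, ln_mult by assumption; ring. }
  assert (Hpos : 0 < y * (1 + y) ^ 2) by (apply Rmult_lt_0_compat; nra).
  apply Rmult_le_reg_r with (y * (1 + y) ^ 2); [assumption|].
  replace (4 * A * / (y * (1 + y) ^ 2) * (y * (1 + y) ^ 2)) with (4 * A)
    by (field; nra).
  destruct (Rle_lt_dec y 1) as [Hy1|Hy1].
  - assert (ln y <= 0) by (rewrite <- ln_1; apply ln_le; lra).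
    rewrite Rabs_left1 by lra.
    replace (- ln x / 2) with (- ln y) by lra.
    rewrite exp_Ropp, exp_ln by assumption.
    replace (h * / y * (y * (1 + y) ^ 2)) with (h * (1 + y) ^ 2) by (field; lra).
    apply Rle_trans with (h * 4); [apply Rmult_le_compat_l|]; nra.
  - assert (0 <= ln y) by (rewrite <- ln_1; apply ln_le; lra).
    rewrite Rabs_pos_eq by lra.
    replace (ln x / 2) with (ln y) by lra.
    rewrite exp_ln by assumption.
    replace (h * y * (y * (1 + y) ^ 2)) with (h * (y * y * (1 + y) ^ 2)) by ring.
    apply Rle_trans with (h * (4 * x ^ 2)); [|lra].
    apply Rmult_le_compat_l; [assumption|].
    rewrite <- Hyy.
    replace (4 * (y * y) ^ 2) with (y * y * (2 * y) ^ 2) by ring.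
    apply Rmult_le_compat_l; [nra|]; apply pow_incr; lra.
Qed.

(** From 1 - y <= e^-y follows e^y - 1 <= y e^y, so the remainder is at most y (e^y - 1). For y >= 0
    the same inequality applies again; for y < 0, e^y - 1 >= y bounds the product by y^2. *)
Lemma exp_taylor2 (y : R) : Rabs (exp y - 1 - y) <= y ^ 2 * exp (Rabs y).
Proof.
  pose proof (exp_ineq1_le y) as H1.
  rewrite Rabs_pos_eq by lra.
  assert (H2 : exp y - 1 <= y * exp y).
  { pose proof (exp_ineq1_le (- y)) as H; rewrite exp_Ropp in H.
    pose proof (exp_pos y).
    apply Rmult_le_compat_r with (r := exp y) in H; [|lra].
    rewrite Rinv_l in H by lra; lra. }
  destruct (Rle_lt_dec 0 y) as [Hy|Hy].
  - rewrite Rabs_pos_eq by assumption; nra.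
  - pose proof (exp_ineq1_le (Rabs y)); pose proof (Rabs_pos y); nra.
Qed.

(** Squaring l / 8 <= exp (l / 8) gives l^2 <= 64 exp (l / 4). A squared logarithm is thus absorbed
    when the exponent rises from 1/4 to 1/2, whence the restriction of t to 1/4 below. *)
Lemma sqr_exp_le (l : R) : 0 <= l -> l ^ 2 * exp (l / 4) <= 64 * exp (l / 2).
Proof.
  intros Hl.
  replace (exp (l / 2)) with (exp (l / 4) * exp (l / 4))
    by (rewrite <- exp_plus; f_equal; lra).
  pose proof (exp_pos (l / 4)).
  assert (l ^ 2 <= 64 * exp (l / 4)); [|nra].
  replace (exp (l / 4)) with (exp (l / 8) * exp (l / 8))
    by (rewrite <- exp_plus; f_equal; lra).
  pose proof (exp_ineq1_le (l / 8)); nra.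
Qed.

Lemma T_succ (m : nat) (x : R) : T (S m) x = T m x + x ^ S m / INR (fact (S m)).
Proof. unfold T; rewrite sum_Sn; reflexivity. Qed.

Lemma T_at_0 (m : nat) : T m 0 = 1.
Proof.
  induction m as [|m IH].
  - unfold T; rewrite sum_O; simpl; field.
  - rewrite T_succ, IH, pow_i by lia; unfold Rdiv; ring.
Qed.

Lemma is_derive_T (m : nat) (x : R) :
  is_derive (T m) x (T m x - x ^ m / INR (fact m)).
Proof.
  induction m as [|m IH].
  - apply is_derive_ext with (fun _ => 1).
    { intros t; unfold T; rewrite sum_O; simpl; field. }
    evar_last; [apply (is_derive_const (V := R_NormedModule))|].
    unfold T, zero; rewrite sum_O; simpl; field.
  - apply is_derive_ext with (fun y => T m y + y ^ S m / INR (fact (S m))).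
    { intros y; now rewrite T_succ. }
    evar_last.
    + apply (is_derive_plus (V := R_NormedModule)); [exact IH|].
      instantiate (1 := x ^ m / INR (fact m)).
      pose proof (INR_fact_neq_0 m); pose proof (not_0_INR (S m) ltac:(lia)).
      rewrite fact_simpl, mult_INR; auto_derive; [exact I|].
      simpl pred; field; split; assumption.
    + rewrite T_succ; unfold plus; simpl; ring.
Qed.

(** The terms are nonnegative, so the left side is at most T_k(x). Any single omitted term is
    allowed because the decay of [hazard] at infinity needs a term of higher degree than its
    behaviour at 0. *)
Lemma T_pow_le_exp (m k : nat) (x : R) :
  0 <= x -> (m < k)%nat -> T m x + x ^ k / INR (fact k) <= exp x.
Proof.
  intros Hx Hmk.
  assert (Hterm : forall j, 0 <= x ^ j / INR (fact j)).
  { intros j; apply Rmult_le_pos; [now apply pow_le|].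
    apply Rlt_le, Rinv_0_lt_compat, INR_fact_lt_0. }
  destruct k as [|k]; [lia|].
  assert (Hmono : T m x <= T k x).
  { replace k with (m + (k - m))%nat by lia.
    induction (k - m)%nat as [|j IH]; [rewrite Nat.add_0_r; lra|].
    rewrite Nat.add_succ_r, T_succ; pose proof (Hterm (S (m + j))); lra. }
  apply Rle_trans with (T (S k) x); [rewrite T_succ; lra|].
  unfold T; rewrite sum_n_Reals; now apply exp_ge_taylor.
Qed.

Lemma pow_le_fact_exp (k : nat) (x : R) : 0 <= x -> x ^ k <= INR (fact k) * exp x.
Proof.
  intros Hx; pose proof (INR_fact_lt_0 k) as Hk.
  assert (H : x ^ k / INR (fact k) <= exp x).
  { destruct k as [|k].
    - simpl; pose proof (exp_ineq1_le x); lra.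
    - pose proof (T_pow_le_exp 0 (S k) x Hx ltac:(lia)) as H.
      unfold T in H; rewrite sum_O in H; simpl in *; lra. }
  apply Rmult_le_compat_l with (r := INR (fact k)) in H; [|lra].
  replace (INR (fact k) * (x ^ k / INR (fact k))) with (x ^ k) in H by (field; lra).
  exact H.
Qed.

(** Gives e^-x T_m(x) = O(1/x), which is enough for the limit of [erlang] at infinity. *)
Lemma mul_T_le_exp (m : nat) :
  exists A, forall x, 0 < x -> x * T m x <= A * exp x.
Proof.
  induction m as [|m [A HA]].
  - exists 1; intros x Hx; unfold T; rewrite sum_O; simpl.
    pose proof (exp_ineq1_le x); lra.
  - exists (A + INR (S (S m))); intros x Hx.
    rewrite T_succ, Rmult_plus_distr_l, Rmult_plus_distr_r.
    apply Rplus_le_compat; [now apply HA|].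
    pose proof (pow_le_fact_exp (S (S m)) x (Rlt_le _ _ Hx)) as H.
    rewrite fact_simpl, mult_INR in H.
    pose proof (INR_fact_lt_0 (S m)) as Hf.
    apply Rmult_le_reg_r with (INR (fact (S m))); [assumption|].
    replace (x * (x ^ S m / INR (fact (S m))) * INR (fact (S m))) with (x ^ S (S m))
      by (rewrite <- (tech_pow_Rmult x (S m)); field; lra).
    lra.
Qed.

(* The distribution function of the Gamma law with parameter m + 1. *)
Definition erlang (m : nat) (x : R) : R := 1 - exp (- x) * T m x.

Lemma erlang_eq (m : nat) (x : R) : erlang m x = exp (- x) * (exp x - T m x).
Proof.
  unfold erlang; rewrite Rmult_minus_distr_l, <- exp_plus, Rplus_opp_l, exp_0.
  reflexivity.
Qed.

Lemma is_derive_erlang (m : nat) (x : R) :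
  is_derive (erlang m) x (x ^ m / INR (fact m) * exp (- x)).
Proof.
  unfold erlang; evar_last.
  - apply (is_derive_minus (V := R_NormedModule) (fun _ => 1));
      [apply (is_derive_const (V := R_NormedModule))|].
    apply (is_derive_mult (fun x => exp (- x)) (T m));
      [|apply is_derive_T|intros; apply Rmult_comm].
    instantiate (1 := - exp (- x)); auto_derive; [exact I|ring].
  - unfold minus, plus, opp, zero, mult; simpl; ring.
Qed.

(** Keeping only the first omitted Taylor term. With [erlang_upper], this places N! G(x) between
    e^-x x^N and x^N, where N = m + 1 and G is [erlang m]. *)
Lemma erlang_lower (m : nat) (x : R) :
  0 <= x -> exp (- x) * (x ^ S m / INR (fact (S m))) <= erlang m x.
Proof.
  intros Hx; rewrite erlang_eq; apply Rmult_le_compat_l; [apply Rlt_le, exp_pos|].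
  pose proof (T_pow_le_exp m (S m) x Hx ltac:(lia)); lra.
Qed.

Lemma erlang_pos (m : nat) (x : R) : 0 < x -> 0 < erlang m x.
Proof.
  intros Hx; eapply Rlt_le_trans; [|apply erlang_lower; lra].
  apply Rmult_lt_0_compat; [apply exp_pos|].
  apply Rmult_lt_0_compat; [now apply pow_lt|].
  apply Rinv_0_lt_compat, INR_fact_lt_0.
Qed.

(** The difference of the two sides vanishes at 0 and has derivative x^m / m! (1 - e^-x) >= 0. *)
Lemma erlang_upper (m : nat) (x : R) :
  0 < x -> erlang m x <= x ^ S m / INR (fact (S m)).
Proof.
  intros Hx.
  destruct (MVT_gen (fun y => y ^ S m / INR (fact (S m)) - erlang m y) 0 x
    (fun y => y ^ m / INR (fact m) - y ^ m / INR (fact m) * exp (- y)))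
    as [c [Hc H]].
  - intros y _.
    apply (is_derive_minus (V := R_NormedModule) (fun y => y ^ S m / INR (fact (S m)))
      (erlang m)); [|apply is_derive_erlang].
    pose proof (INR_fact_neq_0 m); pose proof (not_0_INR (S m) ltac:(lia)).
    rewrite fact_simpl, mult_INR; auto_derive; [exact I|].
    simpl pred; field; split; assumption.
  - intros y _; apply continuity_pt_filterlim.
    apply (continuous_minus (V := R_NormedModule) (fun y => y ^ S m / INR (fact (S m)))
      (erlang m)).
    + apply (ex_derive_continuous (V := R_NormedModule)); auto_derive; exact I.
    + apply (ex_derive_continuous (V := R_NormedModule)).
      eexists; apply is_derive_erlang.
  - rewrite Rmin_left, Rmax_right in Hc by lra.
    unfold erlang at 2 in H; rewrite T_at_0, Ropp_0, exp_0, (pow_i (S m)) in H by lia.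
    assert (0 <= c ^ m / INR (fact m) - c ^ m / INR (fact m) * exp (- c)).
    { replace (c ^ m / INR (fact m) - c ^ m / INR (fact m) * exp (- c))
        with (c ^ m / INR (fact m) * (1 - exp (- c))) by ring.
      apply Rmult_le_pos.
      - apply Rmult_le_pos; [apply pow_le; lra|].
        apply Rlt_le, Rinv_0_lt_compat, INR_fact_lt_0.
      - pose proof (exp_ineq1_le c); rewrite exp_Ropp.
        assert (/ exp c <= / 1) by (apply Rinv_le_contravar; lra).
        rewrite Rinv_1 in *; lra. }
    assert (0 <= (c ^ m / INR (fact m) - c ^ m / INR (fact m) * exp (- c)) * (x - 0))
      by (apply Rmult_le_pos; lra).
    unfold Rdiv in *; lra.
Qed.

(** The target is [at_right 0] rather than [locally 0] so that the limit of [ln] at 0+ can be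
    composed with it. *)
Lemma erlang_lim_0 (m : nat) : filterlim (erlang m) (at_right 0) (at_right 0).
Proof.
  intros P HP.
  assert (Hc : filterlim (erlang m) (at_right 0) (locally 0)).
  { eapply filterlim_filter_le_1; [apply filter_le_within|].
    replace (locally 0) with (locally (erlang m 0)) at 2.
    - apply (ex_derive_continuous (V := R_NormedModule)).
      eexists; apply is_derive_erlang.
    - f_equal; unfold erlang; rewrite T_at_0, Ropp_0, exp_0; ring. }
  specialize (Hc _ HP); unfold filtermap in *.
  destruct Hc as [d Hd]; exists d; intros y Hy Hy0.
  apply (Hd y Hy Hy0), erlang_pos, Hy0.
Qed.

Lemma erlang_lim_oo (m : nat) : filterlim (erlang m) (Rbar_locally p_infty) (locally 1).
Proof.
  destruct (mul_T_le_exp m) as [A HA].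
  change (is_lim (erlang m) p_infty 1).
  apply is_lim_le_le_loc with (fun x => 1 - A * / x) (fun _ => 1).
  - exists 0; intros x Hx; unfold erlang.
    assert (HT : 0 <= T m x).
    { pose proof (T_at_0 m).
      clear - Hx; induction m as [|m IH].
      - unfold T; rewrite sum_O; simpl; lra.
      - rewrite T_succ; apply Rplus_le_le_0_compat; [assumption|].
        apply Rmult_le_pos; [apply pow_le; lra|].
        apply Rlt_le, Rinv_0_lt_compat, INR_fact_lt_0. }
    pose proof (exp_pos (- x)).
    split; [|nra].
    specialize (HA x Hx).
    apply Rmult_le_compat_l with (r := exp (- x) * / x) in HA.
    + replace (exp (- x) * / x * (x * T m x)) with (exp (- x) * T m x) in HA
        by (field; lra).
      replace (exp (- x) * / x * (A * exp x)) with (A * / x * (exp (- x) * exp x)) in HA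
        by ring.
      rewrite <- exp_plus, Rplus_opp_l, exp_0 in HA; lra.
    + apply Rmult_le_pos; [lra|apply Rlt_le, Rinv_0_lt_compat, Hx].
  - evar_last.
    + eapply is_lim_minus; [apply is_lim_const| |].
      * apply is_lim_scal_l, is_lim_inv; [apply is_lim_id|discriminate].
      * simpl; rewrite Rmult_0_r; reflexivity.
    + simpl; f_equal; ring.
  - apply is_lim_const.
Qed.

(** * Expansions of the two real integrals *)

Lemma exp_increasing_le (x y : R) : x <= y -> exp x <= exp y.
Proof.
  intros [H|H]; [now apply Rlt_le, exp_increasing|subst; apply Rle_refl].
Qed.

Lemma is_int_0_oo_scal (f : R -> R) (k l : R) :
  is_int_0_oo f l -> is_int_0_oo (fun x => k * f x) (k * l).
Proof. exact (is_RInt_gen_scal (V := R_NormedModule) f k l). Qed.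

Lemma is_int_0_oo_plus (f g : R -> R) (lf lg : R) :
  is_int_0_oo f lf -> is_int_0_oo g lg -> is_int_0_oo (fun x => f x + g x) (lf + lg).
Proof. exact (is_RInt_gen_plus (V := R_NormedModule) f g lf lg). Qed.

(** The common error estimate: h is a fixed density, and B carries the dependence on t. The 8 is the
    4 of [log_exp_weight] times the integral 2 of [weight]. *)
Lemma is_int_0_oo_log_exp (f h : R -> R) (A B : R) :
  0 <= B ->
  (forall x, 0 < x -> continuous f x) ->
  (forall x, 0 < x -> 0 <= h x <= A /\ x ^ 2 * h x <= A) ->
  (forall x, 0 < x -> Rabs (f x) <= B * (h x * exp (Rabs (ln x) / 2))) ->
  exists l, is_int_0_oo f l /\ Rabs l <= 8 * A * B.
Proof.
  intros HB Hf Hh Hfh.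
  destruct (is_int_0_oo_dominated f (fun x => 4 * A * B * weight x) (4 * A * B * 2))
    as [l [Hl Hl']].
  - exact Hf.
  - intros x Hx; apply (continuous_scal_r (V := R_NormedModule) (4 * A * B) weight).
    now apply continuous_weight.
  - intros x Hx; eapply Rle_trans; [now apply Hfh|].
    destruct (Hh x Hx) as [[H0 H1] H2].
    pose proof (log_exp_weight A (h x) x Hx H0 H1 H2); nra.
  - apply is_int_0_oo_scal, is_int_0_oo_weight.
  - exists l; split; [assumption|lra].
Qed.

Lemma gamma_density_bounds (m : nat) (x : R) :
  0 < x ->
  0 <= x ^ m * exp (- x) <= INR (fact (S (S m))) /\
  x ^ 2 * (x ^ m * exp (- x)) <= INR (fact (S (S m))).
Proof.
  intros Hx.
  assert (H : forall k, 0 <= x ^ k * exp (- x) <= INR (fact k)).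
  { intros k; pose proof (exp_pos (- x)); split.
    - apply Rmult_le_pos; [apply pow_le|]; lra.
    - pose proof (pow_le_fact_exp k x (Rlt_le _ _ Hx)) as H1.
      apply Rmult_le_compat_r with (r := exp (- x)) in H1; [|lra].
      rewrite Rmult_assoc, <- exp_plus, Rplus_opp_r, exp_0 in H1; lra. }
  repeat split; [apply H| |].
  - eapply Rle_trans; [apply H|]; apply le_INR, fact_le; lia.
  - rewrite <- Rmult_assoc, <- pow_add; apply (H (2 + m)%nat).
Qed.

(** The density divided by m! has antiderivative [erlang m], which runs from 0 to 1. *)
Lemma is_int_0_oo_fact (m : nat) :
  is_int_0_oo (fun x => x ^ m * exp (- x)) (INR (fact m)).
Proof.
  pose proof (INR_fact_neq_0 m) as Hm.
  assert (H : is_int_0_oo (fun x => x ^ m / INR (fact m) * exp (- x)) (1 - 0)).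
  { apply (is_int_0_oo_antiderivative (erlang m)).
    - intros; apply is_derive_erlang.
    - intros x Hx; apply (ex_derive_continuous (V := R_NormedModule)).
      auto_derive; exact I.
    - eapply filterlim_filter_le_2; [|apply erlang_lim_0]; apply filter_le_within.
    - apply erlang_lim_oo. }
  apply (is_int_0_oo_scal _ (INR (fact m))) in H.
  replace (INR (fact m) * (1 - 0)) with (INR (fact m)) in H by ring.
  revert H; apply is_int_0_oo_ext; intros; field; assumption.
Qed.

(* For t = a - m - 1 the integral is Gamma(a), and D is Gamma'(m + 1). *)
Lemma is_int_0_oo_gamma (m : nat) :
  exists D A, forall t, Rabs t <= 1 / 4 ->
    exists l, is_int_0_oo (fun x => exp (t * ln x) * (x ^ m * exp (- x))) l /\
      Rabs (l - INR (fact m) - t * D) <= A * t ^ 2.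
Proof.
  set (g := fun x => x ^ m * exp (- x)).
  set (A := INR (fact (S (S m)))).
  (* D is the integral of ln x times the density; B = 2 comes from |ln x| <= 2 exp (|ln x| / 2). *)
  destruct (is_int_0_oo_log_exp (fun x => ln x * g x) g A 2) as [D [HD _]].
  - lra.
  - intros x Hx; unfold g; apply (ex_derive_continuous (V := R_NormedModule)).
    auto_derive; lra.
  - exact (gamma_density_bounds m).
  - intros x Hx; rewrite Rabs_mult.
    destruct (gamma_density_bounds m x Hx) as [[H0 _] _]; fold (g x) in H0.
    rewrite (Rabs_pos_eq (g x)) by assumption.
    pose proof (exp_ineq1_le (Rabs (ln x) / 2)); nra.
  - exists D, (8 * A * 64); intros t Ht.
    (* The integral r of the second-order remainder is O(t^2): [exp_taylor2] bounds the remainder by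
       t^2 (ln x)^2 exp (|t ln x|), and [sqr_exp_le] supplies the 64. *)
    destruct (is_int_0_oo_log_exp (fun x => (exp (t * ln x) - 1 - t * ln x) * g x)
      g A (64 * t ^ 2)) as [r [Hr Hr']].
    + nra.
    + intros x Hx; unfold g; apply (ex_derive_continuous (V := R_NormedModule)).
      auto_derive; lra.
    + exact (gamma_density_bounds m).
    + intros x Hx; rewrite Rabs_mult.
      destruct (gamma_density_bounds m x Hx) as [[H0 _] _]; fold (g x) in H0.
      rewrite (Rabs_pos_eq (g x)) by assumption.
      replace (64 * t ^ 2 * (g x * exp (Rabs (ln x) / 2)))
        with (64 * t ^ 2 * exp (Rabs (ln x) / 2) * g x) by ring.
      apply Rmult_le_compat_r; [assumption|].
      eapply Rle_trans; [apply exp_taylor2|].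
      pose proof (sqr_exp_le (Rabs (ln x)) (Rabs_pos _)) as Hs.
      rewrite Rpow_mult_distr, <- (pow2_abs (ln x)), Rabs_mult.
      assert (He : exp (Rabs t * Rabs (ln x)) <= exp (Rabs (ln x) / 4)).
      { apply exp_increasing_le; pose proof (Rabs_pos (ln x)); nra. }
      apply Rmult_le_compat_l with (r := Rabs (ln x) ^ 2) in He; [|apply pow2_ge_0].
      pose proof (pow2_ge_0 t); nra.
    + exists (INR (fact m) + (t * D + r)); split.
      * apply is_int_0_oo_ext with
          (fun x => g x + (t * (ln x * g x) + (exp (t * ln x) - 1 - t * ln x) * g x)).
        { intros x Hx; unfold g; ring. }
        apply is_int_0_oo_plus; [apply is_int_0_oo_fact|].
        apply is_int_0_oo_plus; [|exact Hr].
        apply is_int_0_oo_scal; exact HD.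
      * replace (INR (fact m) + (t * D + r) - INR (fact m) - t * D) with r by ring; lra.
Qed.

(* The logarithmic derivative of [erlang m]. *)
Definition hazard (m : nat) (x : R) : R := x ^ m / (INR (fact m) * (exp x - T m x)).

Lemma exp_sub_T_pos (m : nat) (x : R) : 0 < x -> 0 < exp x - T m x.
Proof.
  intros Hx; pose proof (erlang_pos m x Hx) as H; rewrite erlang_eq in H.
  pose proof (exp_pos (- x)); nra.
Qed.

Lemma hazard_eq (m : nat) (x : R) :
  0 < x -> hazard m x = x ^ m / INR (fact m) * exp (- x) / erlang m x.
Proof.
  intros Hx; rewrite erlang_eq; unfold hazard.
  pose proof (exp_sub_T_pos m x Hx); pose proof (INR_fact_neq_0 m).
  pose proof (exp_pos (- x)); field; repeat split; lra.
Qed.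

Lemma continuous_hazard (m : nat) (x : R) : 0 < x -> continuous (hazard m) x.
Proof.
  intros Hx; pose proof (exp_sub_T_pos m x Hx); pose proof (INR_fact_lt_0 m).
  apply (ex_derive_continuous (V := R_NormedModule)).
  unfold hazard; apply ex_derive_div; [auto_derive; exact I| |nra].
  apply ex_derive_scal.
  apply (ex_derive_minus (V := R_NormedModule) exp (T m)).
  - eexists; apply is_derive_exp.
  - eexists; apply is_derive_T.
Qed.

(** Near 0, [hazard] behaves like (m + 1) / x; the factor x, which the error estimate of
    [is_int_0_oo_hazard] provides, removes this singularity. The two bounds use the Taylor terms of
    degree m + 1 and m + 3. *)
Lemma hazard_bounds (m : nat) (x : R) :
  0 < x ->
  0 <= x * hazard m x / INR (S m) <= INR (fact (S (S (S m)))) /\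
  x ^ 2 * (x * hazard m x / INR (S m)) <= INR (fact (S (S (S m)))).
Proof.
  intros Hx.
  pose proof (exp_sub_T_pos m x Hx) as HD; pose proof (INR_fact_lt_0 m) as Hm.
  pose proof (lt_0_INR (S m) ltac:(lia)) as Hn.
  assert (HS : INR (fact (S m)) = INR (S m) * INR (fact m))
    by now rewrite fact_simpl, mult_INR.
  assert (Hf1 : 1 <= INR (fact (S m))).
  { apply (le_INR 1); apply lt_O_fact. }
  assert (E : x * hazard m x / INR (S m) = x ^ S m / (INR (fact (S m)) * (exp x - T m x))).
  { rewrite HS; unfold hazard; rewrite <- tech_pow_Rmult; field; lra. }
  assert (H : forall k, (m < k)%nat ->
    x ^ k / (INR (fact (S m)) * (exp x - T m x)) <= INR (fact k)).
  { intros k Hk; pose proof (T_pow_le_exp m k x (Rlt_le _ _ Hx) Hk) as H.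
    pose proof (INR_fact_lt_0 k) as Hfk.
    assert (Hxk : x ^ k <= INR (fact k) * (exp x - T m x)).
    { replace (x ^ k) with (INR (fact k) * (x ^ k / INR (fact k))) by (field; lra).
      apply Rmult_le_compat_l; lra. }
    assert (Hp : 0 < INR (fact (S m)) * (exp x - T m x)) by nra.
    apply Rmult_le_reg_r with (INR (fact (S m)) * (exp x - T m x)); [assumption|].
    unfold Rdiv; rewrite Rmult_assoc, Rinv_l, Rmult_1_r by lra.
    eapply Rle_trans; [exact Hxk|].
    rewrite <- Rmult_assoc; apply Rmult_le_compat_r; [lra|]; nra. }
  rewrite E; repeat split.
  - apply Rmult_le_pos; [apply pow_le; lra|].
    apply Rlt_le, Rinv_0_lt_compat; nra.
  - eapply Rle_trans; [apply H; lia|]; apply le_INR, fact_le; lia.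
  - unfold Rdiv; rewrite <- Rmult_assoc, <- pow_add; apply H; lia.
Qed.

(** Substituting u = G(x), with G = [erlang m], turns this into the integral of u^(t-1) over (0, 1).
    Positivity of t makes u^t vanish at the lower end. *)
Lemma is_int_0_oo_erlang_pow (m : nat) (t : R) :
  0 < t -> is_int_0_oo (fun x => exp (t * ln (erlang m x)) * hazard m x) (/ t).
Proof.
  intros Ht.
  assert (Hc : forall y, 0 < y -> continuous (fun y => exp (t * ln y)) y).
  { intros y Hy; apply (ex_derive_continuous (V := R_NormedModule)).
    auto_derive; exact Hy. }
  assert (He : forall x, continuous (erlang m) x).
  { intros x; apply (ex_derive_continuous (V := R_NormedModule)).
    eexists; apply is_derive_erlang. }
  replace (/ t) with (/ t * exp (t * ln 1) - / t * 0)
    by (rewrite ln_1, Rmult_0_r, exp_0; ring).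
  apply (is_int_0_oo_antiderivative (fun x => / t * exp (t * ln (erlang m x)))).
  - intros x Hx; pose proof (erlang_pos m x Hx); evar_last.
    + apply is_derive_scal.
      apply (is_derive_comp (V := R_NormedModule) (fun y => exp (t * ln y)) (erlang m));
        [|apply is_derive_erlang].
      auto_derive; [assumption|reflexivity].
    + rewrite hazard_eq by assumption.
      pose proof (INR_fact_neq_0 m).
      unfold scal; simpl; unfold mult; simpl; field; repeat split; lra.
  - intros x Hx.
    apply (continuous_mult (K := R_AbsRing) (fun x => exp (t * ln (erlang m x)))).
    + apply (continuous_comp (erlang m) (fun y => exp (t * ln y))); [apply He|].
      now apply Hc, erlang_pos.
    + now apply continuous_hazard.
  - eapply filterlim_comp; [|apply (filterlim_scal_r (K := R_AbsRing)
      (V := R_NormedModule) (/ t) 0)].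
    eapply (filterlim_comp _ _ _ (erlang m) (fun y => exp (t * ln y)));
      [apply erlang_lim_0|].
    eapply (filterlim_comp _ _ _ (fun y => t * ln y) exp _ (Rbar_locally m_infty));
      [|apply is_lim_exp_m].
    eapply (filterlim_comp _ _ _ ln (fun y => t * y)); [apply is_lim_ln_0|].
    pose proof (is_lim_scal_l (fun y => y) t m_infty m_infty (is_lim_id _)) as H.
    replace (Rbar_mult t m_infty) with m_infty in H; [exact H|].
    simpl; destruct (Rle_dec 0 t) as [H0|H0]; [|lra].
    destruct (Rle_lt_or_eq_dec 0 t H0); [reflexivity|lra].
  - eapply filterlim_comp; [|apply (filterlim_scal_r (K := R_AbsRing)
      (V := R_NormedModule) (/ t) (exp (t * ln 1)))].
    eapply (filterlim_comp _ _ _ (erlang m) (fun y => exp (t * ln y)));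
      [apply erlang_lim_oo|].
    apply (Hc 1 Rlt_0_1).
Qed.

(** By the two bounds on G = [erlang m], (N! G)^(t/N) lies between e^(-tx/N) x^t and x^t, so it
    differs from x^t by at most (t x / N) x^t. The main term is integrated exactly and J is the
    integral of the difference. *)
Lemma is_int_0_oo_hazard (m : nat) :
  exists A, forall t, 0 < t <= 1 / 4 ->
    exists J, Rabs J <= A * t /\
      is_int_0_oo (fun x => exp (t * ln x) * hazard m x)
        (exp (t / INR (S m) * ln (INR (fact (S m)))) * (INR (S m) / t) + J).
Proof.
  pose proof (lt_0_INR (S m) ltac:(lia)) as Hn.
  set (n := INR (S m)) in *; set (F := INR (fact (S m))).
  assert (HF : 0 < F) by apply INR_fact_lt_0.
  set (A := INR (fact (S (S (S m))))).
  exists (8 * A); intros t Ht.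
  assert (Hdom : forall x, 0 < x ->
    Rabs (exp (t * ln x) - exp (t / n * ln F) * exp (t / n * ln (erlang m x)))
      <= t * (x / n) * exp (Rabs (ln x) / 2)).
  { intros x Hx; rewrite <- exp_plus.
    pose proof (erlang_pos m x Hx) as Hpos.
    assert (Hpow : 0 < x ^ S m) by now apply pow_lt.
    assert (Hq : 0 < x ^ S m / F)
      by (apply Rmult_lt_0_compat; [assumption|now apply Rinv_0_lt_compat]).
    assert (Hlnq : ln (x ^ S m / F) = n * ln x - ln F).
    { rewrite ln_div, ln_pow by assumption; reflexivity. }
    assert (Hup : ln (erlang m x) <= n * ln x - ln F).
    { rewrite <- Hlnq; apply ln_le; [assumption|now apply erlang_upper]. }
    assert (Hlow : - x + (n * ln x - ln F) <= ln (erlang m x)).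
    { rewrite <- Hlnq, <- (ln_exp (- x)) at 1.
      rewrite <- ln_mult by (assumption || apply exp_pos).
      apply ln_le; [apply Rmult_lt_0_compat; [apply exp_pos|assumption]|].
      apply erlang_lower; lra. }
    (* d is the logarithm of x^t / (N! G)^(t/N); the difference to be bounded is x^t (1 - e^-d), and
       1 - e^-d <= d. *)
    set (d := t / n * (n * ln x - ln F - ln (erlang m x))).
    assert (Htn : 0 < t / n) by (apply Rdiv_lt_0_compat; lra).
    assert (Hd : 0 <= d <= t * (x / n)).
    { split; [apply Rmult_le_pos; lra|].
      replace (t * (x / n)) with (t / n * x) by (field; lra).
      apply Rmult_le_compat_l; lra. }
    replace (t / n * ln F + t / n * ln (erlang m x)) with (t * ln x + - d)
      by (unfold d; field; lra).
    rewrite exp_plus.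
    replace (exp (t * ln x) - exp (t * ln x) * exp (- d))
      with ((1 - exp (- d)) * exp (t * ln x)) by ring.
    pose proof (exp_ineq1_le (- d)).
    assert (exp (- d) <= 1).
    { rewrite <- exp_0; apply exp_increasing_le; lra. }
    rewrite Rabs_mult, (Rabs_pos_eq (1 - _)), (Rabs_pos_eq (exp _))
      by (lra || apply Rlt_le, exp_pos).
    apply Rmult_le_compat; try lra; [apply Rlt_le, exp_pos|].
    apply exp_increasing_le; pose proof (Rle_abs (ln x)); pose proof (Rabs_pos (ln x)); nra. }
  destruct (is_int_0_oo_log_exp
    (fun x => (exp (t * ln x) - exp (t / n * ln F) * exp (t / n * ln (erlang m x)))
              * hazard m x)
    (fun x => x * hazard m x / n) A t) as [J [HJ HJ']].
  - lra.
  - intros x Hx; apply (continuous_mult (K := R_AbsRing)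
      (fun x => exp (t * ln x) - exp (t / n * ln F) * exp (t / n * ln (erlang m x))));
      [|now apply continuous_hazard].
    apply (ex_derive_continuous (V := R_NormedModule)).
    pose proof (erlang_pos m x Hx).
    auto_derive; repeat split; try assumption; eexists; apply is_derive_erlang.
  - exact (hazard_bounds m).
  - intros x Hx; rewrite Rabs_mult.
    assert (H0 : 0 <= hazard m x).
    { destruct (hazard_bounds m x Hx) as [[H0 _] _]; fold n in H0.
      replace (hazard m x) with (x * hazard m x / n * (n / x)) by (field; lra).
      apply Rmult_le_pos; [assumption|apply Rlt_le, Rdiv_lt_0_compat; lra]. }
    rewrite (Rabs_pos_eq (hazard m x)) by assumption.
    eapply Rle_trans; [apply Rmult_le_compat_r; [assumption|now apply Hdom]|].
    right; field; lra.
  - exists J; split; [lra|].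
    apply is_int_0_oo_ext with
      (fun x => exp (t / n * ln F) * (exp (t / n * ln (erlang m x)) * hazard m x) +
        (exp (t * ln x) - exp (t / n * ln F) * exp (t / n * ln (erlang m x)))
              * hazard m x).
    { intros; ring. }
    apply is_int_0_oo_plus; [|exact HJ].
    apply is_int_0_oo_scal.
    (* The exact integral is used with exponent t / n in place of t. *)
    replace (n / t) with (/ (t / n)) by (field; lra).
    apply is_int_0_oo_erlang_pow, Rdiv_lt_0_compat; lra.
Qed.

(** * Gamma and zeta at real arguments *)

(** [CInt_0_oo] selects a value by uniqueness, so convergence must be exhibited: the real component
    is the integral of g, the imaginary one that of 0. *)
Lemma CInt_0_oo_real (f : R -> C) (g : R -> R) (l : R) :
  (forall x, 0 < x -> f x = RtoC (g x)) -> is_int_0_oo g l ->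
  CInt_0_oo f = RtoC l.
Proof.
  intros Hfg Hg; unfold CInt_0_oo; apply (is_RInt_gen_unique (V := C_R_CompleteNormedModule)).
  apply is_RInt_gen_ext with (fun x => RtoC (g x)).
  { apply filter_prod_0_oo; intros a b Ha Hb x; simpl.
    rewrite Rmin_left, Rmax_right by lra.
    intros Hx; symmetry; apply Hfg; lra. }
  intros P [d Hd].
  assert (HQ : locally l (fun y => P (RtoC y))).
  { exists d; intros y Hy; apply Hd; split; [exact Hy|apply ball_center]. }
  unfold is_int_0_oo, is_RInt_gen, filterlimi, filter_le, filtermapi in Hg |- *.
  generalize (Hg _ HQ); apply filter_imp.
  intros ab [y [Hy Py]]; exists (RtoC y); split; [|exact Py].
  apply (is_RInt_fct_extend_pair (U := R_NormedModule) (V := R_NormedModule));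
    simpl; [exact Hy|].
  evar_last; [apply (is_RInt_const (V := R_NormedModule))|].
  unfold scal; simpl; unfold mult; simpl; ring.
Qed.

Lemma Rcpow_real (x a : R) : Rcpow x (RtoC a) = RtoC (exp (a * ln x)).
Proof.
  unfold Rcpow, Cexp, RtoC; simpl.
  rewrite !Rmult_0_r, Rmult_0_l, Rplus_0_l, Rminus_0_r, cos_0, sin_0.
  f_equal; ring.
Qed.

Lemma exp_plus_INR_ln (m : nat) (t x : R) :
  0 < x -> exp ((t + INR m) * ln x) = exp (t * ln x) * x ^ m.
Proof.
  intros Hx; rewrite Rmult_plus_distr_r, exp_plus; f_equal.
  exact (Rpower_pow m x Hx).
Qed.

Lemma Gamma_real (m : nat) (t l : R) :
  is_int_0_oo (fun x => exp (t * ln x) * (x ^ m * exp (- x))) l ->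
  Gamma (RtoC (INR (S m) + t)) = RtoC l.
Proof.
  intros H; unfold Gamma; apply CInt_0_oo_real with (2 := H).
  intros x Hx.
  replace (RtoC (INR (S m) + t) - 1)%C with (RtoC (t + INR m))
    by (rewrite <- RtoC_minus, S_INR; f_equal; ring).
  rewrite Rcpow_real, exp_plus_INR_ln, <- RtoC_mult by assumption.
  f_equal; ring.
Qed.

Lemma Gamma_expansion (m : nat) :
  exists D A, forall t, Rabs t <= 1 / 4 ->
    exists l, Gamma (RtoC (INR (S m) + t)) = RtoC l /\
      Rabs (l - INR (fact m) - t * D) <= A * t ^ 2.
Proof.
  destruct (is_int_0_oo_gamma m) as [D [A H]]; exists D, A; intros t Ht.
  destruct (H t Ht) as [l [Hl Hl']]; exists l; split; [|assumption].
  now apply Gamma_real.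
Qed.

Lemma Gamma_nat (m : nat) : Gamma (RtoC (INR (S m))) = RtoC (INR (fact m)).
Proof.
  rewrite <- (Rplus_0_r (INR (S m))); apply Gamma_real.
  apply is_int_0_oo_ext with (2 := is_int_0_oo_fact m).
  intros x Hx; rewrite Rmult_0_l, exp_0; ring.
Qed.

Lemma is_lim_Lipschitz (q : R -> R) (x0 l A d : R) :
  0 < d ->
  (forall t, t <> 0 -> Rabs t <= d -> Rabs (q (x0 + t) - l) <= A * Rabs t) ->
  is_lim q x0 l.
Proof.
  intros Hd H; apply is_lim_spec; intros eps; simpl.
  assert (HA : 0 < Rabs A + 1) by (pose proof (Rabs_pos A); lra).
  assert (He : 0 < Rmin d (eps / (Rabs A + 1))).
  { apply Rmin_glb_lt; [assumption|].
    apply Rdiv_lt_0_compat; [apply cond_pos|assumption]. }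
  exists (mkposreal _ He); intros y Hy Hy0.
  assert (Hy' : Rabs (y - x0) < Rmin d (eps / (Rabs A + 1))) by exact Hy.
  assert (H1 := Rmin_l d (eps / (Rabs A + 1))).
  assert (H2 := Rmin_r d (eps / (Rabs A + 1))).
  assert (Ht : y - x0 <> 0) by (contradict Hy0; lra).
  specialize (H (y - x0) Ht ltac:(lra)).
  rewrite Rplus_minus in H.
  assert (H3 : Rabs (y - x0) < eps / (Rabs A + 1)) by lra.
  apply Rmult_lt_compat_r with (r := Rabs A + 1) in H3; [|assumption].
  replace (eps / (Rabs A + 1) * (Rabs A + 1)) with (pos eps) in H3 by (field; lra).
  pose proof (Rle_abs A); pose proof (Rabs_pos (y - x0)); nra.
Qed.

(** The hypothesis is the expansion of [Gamma_expansion]. Dividing it by t shows that the difference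
    quotient at real increments is a real q with |q - D| <= A |t|. *)
Lemma C_derive_Gamma_nat (m : nat) (D A : R) :
  (forall t, Rabs t <= 1 / 4 ->
    exists l, Gamma (RtoC (INR (S m) + t)) = RtoC l /\
      Rabs (l - INR (fact m) - t * D) <= A * t ^ 2) ->
  C_derive Gamma (RtoC (INR (S m))) = RtoC D.
Proof.
  intros H.
  assert (Hq : forall t, t <> 0 -> Rabs t <= 1 / 4 -> exists q, Rabs (q - D) <= A * Rabs t /\
    ((Gamma (RtoC (INR (S m) + t)) - Gamma (RtoC (INR (S m)))) /
     (RtoC (INR (S m) + t) - RtoC (INR (S m))))%C = RtoC q).
  { intros t Ht0 Ht; destruct (H t Ht) as [l [Hl Hl']].
    exists ((l - INR (fact m)) / t); split.
    - replace ((l - INR (fact m)) / t - D) with ((l - INR (fact m) - t * D) / t)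
        by (field; assumption).
      unfold Rdiv; rewrite Rabs_mult, Rabs_inv.
      pose proof (Rabs_pos_lt t Ht0).
      apply Rmult_le_reg_r with (Rabs t); [assumption|].
      rewrite Rmult_assoc, Rinv_l, Rmult_1_r by lra.
      rewrite <- (pow2_abs t) in Hl'; lra.
    - rewrite Hl, Gamma_nat, <- !RtoC_minus, <- RtoC_div.
      + do 2 f_equal; ring.
      + replace (INR (S m) + t - INR (S m)) with t by ring; assumption. }
  set (quot := fun z : C => ((Gamma z - Gamma (RtoC (INR (S m)))) /
                             (z - RtoC (INR (S m))))%C) in *.
  change (C_lim quot (RtoC (INR (S m))) = (D, 0)).
  (* [C_lim] pairs the limits of the two components along the real direction; the imaginary one is
     constantly 0, hence the constant 0 below. *)
  unfold C_lim; apply f_equal2; apply (f_equal real (y := Finite _)), is_lim_unique.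
  - apply is_lim_Lipschitz with A (1 / 4); [lra|]; intros t Ht0 Ht.
    destruct (Hq t Ht0 Ht) as [q [Hq1 Hq2]].
    change (Rabs (fst (quot (RtoC (INR (S m) + t))) - D) <= A * Rabs t).
    unfold quot; rewrite Hq2; exact Hq1.
  - apply is_lim_Lipschitz with 0 (1 / 4); [lra|]; intros t Ht0 Ht.
    destruct (Hq t Ht0 Ht) as [q [_ Hq2]].
    change (Rabs (snd (quot (RtoC (INR (S m) + t))) - 0) <= 0 * Rabs t).
    unfold quot; rewrite Hq2; simpl; rewrite Rminus_0_r, Rabs_R0; lra.
Qed.

Lemma zeta_int_real (m : nat) (t l I : R) :
  is_int_0_oo (fun x => exp (t * ln x) * hazard m x) I ->
  Gamma (RtoC (INR (S m) + t)) = RtoC l ->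
  zeta_int (S m) (RtoC (1 + t)) = (/ RtoC l * RtoC (INR (fact m) * I))%C.
Proof.
  intros HI Hl; unfold zeta_int.
  replace (RtoC (1 + t) + RtoC (INR (S m)) - 1)%C with (RtoC (INR (S m) + t))
    by (rewrite <- RtoC_plus, <- RtoC_minus; f_equal; ring).
  rewrite Hl; f_equal.
  apply CInt_0_oo_real with (2 := is_int_0_oo_scal _ (INR (fact m)) _ HI).
  intros x Hx.
  replace (RtoC (1 + t) + RtoC (INR (S m)) - 2)%C with (RtoC (t + INR m))
    by (rewrite <- RtoC_plus, <- RtoC_minus, S_INR; f_equal; ring).
  rewrite Rcpow_real, exp_plus_INR_ln by assumption.
  replace (S m - 1)%nat with m by lia.
  pose proof (exp_sub_T_pos m x Hx); pose proof (INR_fact_neq_0 m).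
  rewrite <- RtoC_div by lra.
  f_equal; unfold hazard; field; lra.
Qed.

(** Pure real algebra, applied with M = (N-1)!, n = N, l = ln (N!), g = Gamma(N + t), D = Gamma'(N)
    and J the error of the zeta integral. *)
Lemma quotient_expansion (M n l D A1 A2 : R) :
  0 < M -> 0 < n ->
  exists K d, 0 < d /\ forall t g J, 0 < t <= d ->
    Rabs J <= A1 * t -> Rabs (g - M - t * D) <= A2 * t ^ 2 ->
    0 < g /\
    Rabs (/ g * (M * (exp (t / n * l) * (n / t) + J)) - n / t - (l - n * (D / M)))
      <= K * t.
Proof.
  intros HM Hn.
  set (B := Rabs D + Rabs A2).
  set (A3 := (l / n) ^ 2 * exp (Rabs (l / n))).
  set (L := l - n * (D / M)).
  exists ((M * (n * A3 + A1) + n * A2 + B * Rabs L) * / (M / 2)).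
  assert (HB : 0 <= B) by (unfold B; pose proof (Rabs_pos D); pose proof (Rabs_pos A2); lra).
  (* Since |g - M| <= B t for t <= 1, this radius keeps g >= M / 2; hence the factor / (M / 2) in
     K. *)
  exists (Rmin 1 (M / 2 / (B + 1))); split.
  { apply Rmin_glb_lt; [lra|]; apply Rdiv_lt_0_compat; lra. }
  intros t g J [Ht Htd] HJ Hg.
  pose proof (Rmin_l 1 (M / 2 / (B + 1))) as H1.
  pose proof (Rmin_r 1 (M / 2 / (B + 1))) as H2.
  assert (Ht1 : t <= 1) by lra.
  assert (HtB : t * (B + 1) <= M / 2).
  { replace (M / 2) with (M / 2 / (B + 1) * (B + 1)) by (field; lra).
    apply Rmult_le_compat_r; lra. }
  assert (Hg3 : Rabs (g - M) <= B * t).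
  { replace (g - M) with ((g - M - t * D) + t * D) by ring.
    eapply Rle_trans; [apply Rabs_triang|].
    rewrite Rabs_mult, (Rabs_pos_eq t) by lra.
    assert (H3 : A2 * t ^ 2 <= Rabs A2 * t).
    { apply Rle_trans with (Rabs A2 * t ^ 2).
      - apply Rmult_le_compat_r; [apply pow2_ge_0|apply Rle_abs].
      - apply Rmult_le_compat_l; [apply Rabs_pos|nra]. }
    unfold B; lra. }
  assert (HgM : M / 2 <= g) by (apply Rabs_le_between in Hg3; nra).
  split; [lra|].
  set (y := t / n * l).
  assert (He : Rabs (exp y - 1 - y) <= A3 * t ^ 2).
  { eapply Rle_trans; [apply exp_taylor2|].
    replace y with (t * (l / n)) by (unfold y; field; lra).
    rewrite Rabs_mult, (Rabs_pos_eq t), Rpow_mult_distr by lra.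
    assert (exp (t * Rabs (l / n)) <= exp (Rabs (l / n))).
    { apply exp_increasing_le; pose proof (Rabs_pos (l / n)); nra. }
    unfold A3; pose proof (pow2_ge_0 (l / n)); pose proof (pow2_ge_0 t).
    rewrite Rmult_assoc, (Rmult_comm (t ^ 2)).
    apply Rmult_le_compat_r; [assumption|]; apply Rmult_le_compat_l; assumption. }
  (* Over the common denominator g, the poles M n / t cancel, and the constants M l - n D - M L
     cancel by the choice of L. Only the three remainders are left, each O(t). *)
  replace (/ g * (M * (exp y * (n / t) + J)) - n / t - L)
    with ((M * (n * ((exp y - 1 - y) / t) + J) - n * ((g - M - t * D) / t) - (g - M) * L)
          * / g)
    by (unfold L, y; field; lra).
  assert (Hdiv : forall z A, Rabs z <= A * t ^ 2 -> Rabs (z / t) <= A * t).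
  { intros z A Hz; unfold Rdiv; rewrite Rabs_mult, Rabs_inv, (Rabs_pos_eq t) by lra.
    apply Rmult_le_reg_r with t; [assumption|].
    rewrite Rmult_assoc, Rinv_l, Rmult_1_r by lra; lra. }
  apply Hdiv in He, Hg.
  rewrite Rabs_mult, (Rabs_pos_eq (/ g)) by (apply Rlt_le, Rinv_0_lt_compat; lra).
  replace ((M * (n * A3 + A1) + n * A2 + B * Rabs L) * / (M / 2) * t)
    with ((M * (n * (A3 * t) + A1 * t) + n * (A2 * t) + B * t * Rabs L) * / (M / 2))
    by (field; lra).
  apply Rmult_le_compat; [apply Rabs_pos|apply Rlt_le, Rinv_0_lt_compat; lra| |].
  - unfold Rminus at 1 2; eapply Rle_trans; [apply Rabs_triang|].
    apply Rplus_le_compat.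
    + eapply Rle_trans; [apply Rabs_triang|]; rewrite Rabs_Ropp.
      rewrite !Rabs_mult, (Rabs_pos_eq M), (Rabs_pos_eq n) by lra.
      apply Rplus_le_compat; apply Rmult_le_compat_l; try lra.
      eapply Rle_trans; [apply Rabs_triang|].
      rewrite Rabs_mult, (Rabs_pos_eq n) by lra.
      apply Rplus_le_compat; [apply Rmult_le_compat_l; lra|assumption].
    + rewrite Rabs_Ropp, Rabs_mult.
      apply Rmult_le_compat_r; [apply Rabs_pos|assumption].
  - apply Rinv_le_contravar; lra.
Qed.

(** * Laurent expansions *)

(** The uniform structure of C is that of a product; this passes to discs for the modulus. *)
Lemma locally_C (p : C) (P : C -> Prop) :
  locally p P <-> exists e : posreal, forall y, Cmod (y - p) < e -> P y.
Proof.
  split; intros H.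
  - exact (locally_norm_le_locally (V := C_NormedModule) p P H).
  - exact (locally_le_locally_norm (V := C_NormedModule) p P H).
Qed.

(** Convergence at x0 bounds the partial sums by some B and the terms by 2 B. For |x| <= |x0| / 2
    the terms are dominated by 2 B r^k with r = |x| / |x0| <= 1/2, and everything past the constant
    term sums to at most 4 B r. *)
Lemma is_pseries_C_bound (a : nat -> C) (x0 : C) (l : C) :
  x0 <> 0%C -> @is_pseries C_AbsRing C_NormedModule a x0 l ->
  exists A, forall x v, 2 * Cmod x <= Cmod x0 ->
    @is_pseries C_AbsRing C_NormedModule a x v ->
    Cmod (v - a 0%nat) <= A * Cmod x.
Proof.
  intros Hx0 Hl.
  assert (Hpow : forall (x : C) k, Cmod (@pow_n C_AbsRing x k) = Cmod x ^ k).
  { intros x k; induction k as [|k IH]; [apply Cmod_1|].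
    change (Cmod (x * @pow_n C_AbsRing x k)%C = Cmod x ^ S k).
    now rewrite Cmod_mult, IH. }
  set (u := fun x k => scal (V := C_NormedModule) (@pow_n C_AbsRing x k) (a k)) in *.
  assert (Hu : forall x k, Cmod (u x k) = Cmod x ^ k * Cmod (a k)).
  { intros x k; rewrite <- Hpow; apply Cmod_mult. }
  assert (HS : forall x k,
    sum_n (G := C_NormedModule) (u x) (S k) = (sum_n (G := C_NormedModule) (u x) k + u x (S k))%C).
  { intros x k; exact (sum_Sn (G := C_NormedModule) (u x) k). }
  assert (HS0 : forall x, sum_n (G := C_NormedModule) (u x) 0 = a 0%nat).
  { intros x; rewrite sum_O; exact (Cmult_1_l (a 0%nat)). }
  destruct (filterlim_bounded (V := C_NormedModule) (sum_n (u x0)) (ex_intro _ l Hl))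
    as [B HB].
  assert (HB' : forall k, Cmod (u x0 k) <= 2 * B).
  { intros k.
    assert (HBk : forall k, Cmod (sum_n (G := C_NormedModule) (u x0) k) <= B) by exact HB.
    destruct k as [|k].
    - pose proof (HBk 0%nat) as H0; rewrite sum_O in H0.
      pose proof (Cmod_ge_0 (u x0 0%nat)); lra.
    - replace (u x0 (S k)) with (sum_n (G := C_NormedModule) (u x0) (S k)
        + - sum_n (G := C_NormedModule) (u x0) k)%C by (rewrite HS; ring).
      eapply Rle_trans; [apply Cmod_triangle|]; rewrite Cmod_opp.
      pose proof (HBk k); pose proof (HBk (S k)); lra. }
  apply Cmod_gt_0 in Hx0.
  exists (4 * B * / Cmod x0); intros x v Hx Hv.
  set (r := Cmod x / Cmod x0).
  assert (Hr : 0 <= r <= / 2).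
  { split; [apply Rmult_le_pos; [apply Cmod_ge_0|apply Rlt_le, Rinv_0_lt_compat, Hx0]|].
    apply Rmult_le_reg_r with (Cmod x0); [assumption|].
    unfold r, Rdiv; rewrite Rmult_assoc, Rinv_l by lra; lra. }
  assert (Hur : forall k, Cmod (u x k) <= 2 * B * r ^ k).
  { intros k; rewrite Hu.
    replace (Cmod x) with (Cmod x0 * r) by (unfold r; field; lra).
    rewrite Rpow_mult_distr.
    replace (Cmod x0 ^ k * r ^ k * Cmod (a k)) with (Cmod (u x0 k) * r ^ k)
      by (rewrite Hu; ring).
    apply Rmult_le_compat_r; [apply pow_le; lra|apply HB']. }
  assert (HB0 : 0 <= B) by (pose proof (HB' 0%nat); pose proof (Cmod_ge_0 (u x0 0%nat)); lra).
  (* The geometric sum r + ... + r^k is at most 2 r (1 - r^k), because 1 / (1 - r) <= 2; keeping the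
     subtracted term lets the induction close. *)
  assert (Hsum : forall k, Cmod (sum_n (G := C_NormedModule) (u x) k - a 0%nat)
      <= 2 * B * (2 * r - 2 * r * r ^ k)).
  { induction k as [|k IH].
    - rewrite HS0; replace (a 0%nat - a 0%nat)%C with (RtoC 0) by ring.
      rewrite Cmod_0; simpl; lra.
    - rewrite HS.
      replace (sum_n (G := C_NormedModule) (u x) k + u x (S k) - a 0%nat)%C
        with ((sum_n (G := C_NormedModule) (u x) k - a 0%nat) + u x (S k))%C by ring.
      eapply Rle_trans; [apply Cmod_triangle|].
      pose proof (Hur (S k)) as H1.
      assert (Hp : 0 <= r ^ S k) by (apply pow_le; lra).
      assert (H2 : r ^ S k <= 2 * r ^ S k * (1 - r)) by nra.
      replace (2 * r * r ^ k) with (2 * r ^ S k) in IH by (simpl; ring).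
      assert (2 * B * r ^ S k <= 2 * B * (2 * r ^ S k * (1 - r)))
        by (apply Rmult_le_compat_l; lra).
      nra. }
  apply le_epsilon; intros eps Heps.
  assert (Hloc : locally (v : C) (fun y : C => Cmod (y - v) < eps)).
  { apply locally_C; exists (mkposreal eps Heps); auto. }
  destruct (Hv _ Hloc) as [k Hk].
  specialize (Hk k (le_n k)); specialize (Hsum k); fold (u x) in Hk; simpl in Hk.
  replace (v - a 0%nat)%C with
    ((sum_n (G := C_NormedModule) (u x) k - a 0%nat) +
     - (sum_n (G := C_NormedModule) (u x) k - v))%C by ring.
  eapply Rle_trans; [apply Cmod_triangle|]; rewrite Cmod_opp.
  assert (0 <= 2 * r * r ^ k) by (apply Rmult_le_pos; [lra|apply pow_le; lra]).
  replace (4 * B * / Cmod x0 * Cmod x) with (2 * B * (2 * r)) by (unfold r, Rdiv; ring).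
  assert (2 * B * (2 * r - 2 * r * r ^ k) <= 2 * B * (2 * r)) by nra.
  apply Rplus_le_compat; [lra|apply Rlt_le, Hk].
Qed.

(** The reference point p + d/2 lies inside the punctured disc of convergence, so the preceding
    bound holds for |s - p| <= d/4. *)
Lemma is_pseries_C_lim (a : nat -> C) (f : C -> C) (p : C) :
  locally' p (fun s => @is_pseries C_AbsRing C_NormedModule a (s - p)%C (f s)) ->
  filterlim f (locally' p) (locally (a 0%nat)).
Proof.
  intros H; apply locally_C in H; destruct H as [d Hd].
  assert (Hd2 : Cmod (RtoC (d / 2)) = d / 2).
  { rewrite Cmod_R; apply Rabs_pos_eq; pose proof (cond_pos d); lra. }
  assert (Hx0 : RtoC (d / 2) <> 0%C).
  { apply Cmod_gt_0; rewrite Hd2; pose proof (cond_pos d); lra. }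
  assert (Hp : (p + RtoC (d / 2) - p)%C = RtoC (d / 2)) by ring.
  destruct (is_pseries_C_bound a (RtoC (d / 2)) (f (p + RtoC (d / 2))%C) Hx0)
    as [A HA].
  { rewrite <- Hp at 1; apply Hd.
    - rewrite Hp, Hd2; pose proof (cond_pos d); lra.
    - intros E; apply Hx0; rewrite <- Hp, E; ring. }
  intros P HP; apply locally_C in HP; destruct HP as [e He].
  apply locally_C.
  assert (HA' : 0 < Rabs A + 1) by (pose proof (Rabs_pos A); lra).
  assert (Hm : 0 < Rmin (d / 4) (e / (Rabs A + 1))).
  { apply Rmin_glb_lt; [pose proof (cond_pos d); lra|].
    apply Rdiv_lt_0_compat; [apply cond_pos|assumption]. }
  exists (mkposreal _ Hm); simpl; intros y Hy Hyp.
  pose proof (Rmin_l (d / 4) (e / (Rabs A + 1))) as H1.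
  pose proof (Rmin_r (d / 4) (e / (Rabs A + 1))) as H2.
  apply He; eapply Rle_lt_trans.
  - apply (HA (y - p)%C); [rewrite Hd2; lra|].
    apply Hd; [pose proof (cond_pos d); lra|exact Hyp].
  - assert (H3 : Cmod (y - p) < e / (Rabs A + 1)) by lra.
    apply Rmult_lt_compat_r with (r := Rabs A + 1) in H3; [|assumption].
    replace (e / (Rabs A + 1) * (Rabs A + 1)) with (pos e) in H3 by (field; lra).
    pose proof (Rle_abs A); pose proof (Cmod_ge_0 (y - p)); nra.
Qed.

Lemma right_approach_C (p : C) :
  filterlim (fun t : R => (p + RtoC t)%C) (at_right 0) (locally' p).
Proof.
  intros P HP; apply locally_C in HP; destruct HP as [e He].
  exists e; intros t Ht Ht0; apply He.
  - replace (p + RtoC t - p)%C with (RtoC t) by ring.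
    rewrite Cmod_R.
    assert (Ht' : Rabs (t - 0) < e) by exact Ht.
    now rewrite Rminus_0_r in Ht'.
  - intros E.
    assert (E' : RtoC t = RtoC 0) by (replace (RtoC t) with (p + RtoC t - p)%C by ring;
      rewrite E; ring).
    apply (f_equal fst) in E'; simpl in E'; lra.
Qed.

(* A finite limit along one ray forces the principal part of h to vanish. *)
Lemma laurent_lim (m : nat) (a : nat -> C) (h : C -> C) (p L : C) :
  locally' p (fun s =>
    @is_pseries C_AbsRing C_NormedModule a (s - p)%C ((s - p) ^ m * h s)%C) ->
  filterlim (fun t : R => h (p + RtoC t)%C) (at_right 0) (locally L) ->
  filterlim h (locally' p) (locally L).
Proof.
  revert a; induction m as [|m IH]; intros a Ha HL;
    pose proof (is_pseries_C_lim a _ p Ha) as Hlim;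
    pose proof (filterlim_comp _ _ _ _ _ _ _ _ (right_approach_C p) Hlim) as Hray.
  - assert (HLa : L = a 0%nat).
    { apply (filterlim_locally_unique (K := C_AbsRing) (V := C_NormedModule)
        (F := at_right 0) (fun t : R => h (p + RtoC t)%C)); [exact HL|].
      revert Hray; apply filterlim_ext; intros t; apply Cmult_1_l. }
    rewrite HLa; revert Hlim; apply filterlim_ext; intros s; apply Cmult_1_l.
  (* Along the ray, (s - p)^(m+1) h(s) tends to 0 * L, so the constant coefficient vanishes and one
     factor s - p can be divided out of the series. *)
  - assert (H0 : a 0%nat = 0%C).
    { apply (filterlim_locally_unique (K := C_AbsRing) (V := C_NormedModule)
        (F := at_right 0)
        (fun t : R => ((p + RtoC t - p) ^ S m * h (p + RtoC t))%C)); [exact Hray|].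
      replace (RtoC 0) with (0 * L)%C by ring.
      apply (filterlim_comp_2 (G := locally (RtoC 0 : C_AbsRing))
        (H := locally (L : C_NormedModule)) _ _ Cmult); [|exact HL|].
      - apply (filterlim_comp _ _ _ (fun t : R => RtoC t) (fun z => (p + z - p) ^ S m)%C
          _ (locally (RtoC 0))).
        + intros P HP; apply locally_C in HP; destruct HP as [e He].
          exists e; intros t Ht _; apply He.
          assert (Ht' : Rabs (t - 0) < e) by exact Ht.
          now rewrite <- RtoC_minus, Cmod_R.
        + intros P [e He]; apply locally_C.
          assert (Hm : 0 < Rmin 1 e) by (apply Rmin_glb_lt; [lra|apply cond_pos]).
          exists (mkposreal _ Hm); simpl pos; intros z Hz; apply He.
          change (Cmod ((p + z - p) ^ S m - 0)%C < e).
          pose proof (Rmin_l 1 e); pose proof (Rmin_r 1 e).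
          replace (z - 0)%C with z in Hz by ring.
          replace ((p + z - p) ^ S m - 0)%C with (z ^ S m)%C
            by (replace (p + z - p)%C with z by ring; ring).
          rewrite Cmod_pow; simpl.
          pose proof (Cmod_ge_0 z).
          assert (Cmod z ^ m <= 1).
          { rewrite <- (pow1 m); apply pow_incr; lra. }
          nra.
      - exact (filterlim_scal (K := C_AbsRing) (V := C_NormedModule) (RtoC 0) L). }
    apply IH with (@PS_decr_1 C_AbsRing C_NormedModule a); [|exact HL].
    apply locally_C in Ha; destruct Ha as [d Hd]; apply locally_C; exists d.
    intros s Hs Hsp; specialize (Hd s Hs Hsp).
    pose proof (Cminus_eq_contra s p Hsp) as Hne.
    apply (is_pseries_decr_1 (K := C_AbsRing) (V := C_NormedModule) a (s - p)%C (/ (s - p))%C)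
      in Hd; [|exact (Cinv_l _ Hne)].
    rewrite H0 in Hd.
    replace ((s - p) ^ m * h s)%C with
      (/ (s - p) * ((s - p) ^ S m * h s + - 0))%C; [exact Hd|].
    simpl Cpow; field; exact Hne.
Qed.

Lemma is_pseries_C_monomial (c x : C) (n : nat) :
  @is_pseries C_AbsRing C_NormedModule
    (PS_incr_n (V := C_NormedModule) (fun k => match k with O => c | S _ => RtoC 0 end) n)
    x (x ^ n * c)%C.
Proof.
  replace (x ^ n)%C with (@pow_n C_AbsRing x n).
  - apply (is_pseries_incr_n (K := C_AbsRing) (V := C_NormedModule)).
    apply filterlim_ext with (fun _ => c); [|apply filterlim_const].
    intros k; symmetry; induction k as [|k IH].
    + rewrite sum_O; exact (Cmult_1_l c).
    + rewrite sum_Sn, IH.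
      change (c + @pow_n C_AbsRing x (S k) * 0 = c)%C; ring.
  - induction n as [|n IH]; [reflexivity|].
    change (x * @pow_n C_AbsRing x n = x * x ^ n)%C; now rewrite IH.
Qed.

(** If (s - p)^n Z(s) is a power series, one more factor s - p also clears c / (s - p): the series
    is shifted by one and - c (s - p)^n is added. Then [laurent_lim] applies. *)
Lemma meromorphic_sub_pole_lim (Z : C -> C) (p c L : C) :
  meromorphic_at Z p ->
  filterlim (fun t : R => (Z (p + RtoC t) - c / (p + RtoC t - p))%C)
    (at_right 0) (locally L) ->
  filterlim (fun s => Z s - c / (s - p))%C (locally' p) (locally L).
Proof.
  intros [n [a Ha]] HL.
  apply (laurent_lim (S n) (PS_plus (V := C_NormedModule)
      (PS_incr_n (V := C_NormedModule) a 1)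
      (PS_incr_n (V := C_NormedModule)
        (fun k => match k with O => (- c)%C | S _ => RtoC 0 end) n))
    (fun s => Z s - c / (s - p))%C); [|exact HL].
  apply locally_C in Ha; destruct Ha as [d Hd]; apply locally_C; exists d.
  intros s Hs Hsp; specialize (Hd s Hs).
  pose proof (Cminus_eq_contra s p Hsp) as Hne.
  replace ((s - p) ^ S n * (Z s - c / (s - p)))%C with
    ((s - p) * 1 * ((s - p) ^ n * Z s) + (s - p) ^ n * - c)%C
    by (simpl Cpow; field; exact Hne).
  apply (is_pseries_plus (K := C_AbsRing) (V := C_NormedModule));
    [|apply is_pseries_C_monomial].
  exact (is_pseries_incr_n (K := C_AbsRing) (V := C_NormedModule) a 1 _ _ Hd).
Qed.

(** * The limit at s = 1 *)

Theorem theorem3p2 :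
  forall (N : nat) (zetaN : C -> C),
    (1 <= N)%nat ->
    is_zeta N zetaN ->
    filterlim (fun s : C => zetaN s - RtoC (INR N) / (s - 1))%C
      (locally' (RtoC 1))
      (locally (RtoC (ln (INR (fact N))) -
                RtoC (INR N) * (C_derive Gamma (RtoC (INR N)) /
                                Gamma (RtoC (INR N))))%C).
Proof.
  intros N Z HN [Hmero Hint].
  destruct N as [|m]; [lia|]; clear HN.
  apply meromorphic_sub_pole_lim; [apply Hmero|].
  destruct (Gamma_expansion m) as [D [A2 HG]].
  destruct (is_int_0_oo_hazard m) as [A1 HJ].
  pose proof (INR_fact_lt_0 m) as HM; pose proof (lt_0_INR (S m) ltac:(lia)) as Hn.
  (* With N = m + 1, Gamma'(N) = D and Gamma(N) = m!, so the limit becomes the real number named [L]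
     below. *)
  rewrite (C_derive_Gamma_nat m D A2 HG), Gamma_nat.
  rewrite <- RtoC_div, <- RtoC_mult, <- RtoC_minus by lra.
  destruct (quotient_expansion (INR (fact m)) (INR (S m)) (ln (INR (fact (S m)))) D A1 A2
    HM Hn) as [K [d [Hd HK]]].
  set (L := ln (INR (fact (S m))) - INR (S m) * (D / INR (fact m))) in *.
  intros P HP; apply locally_C in HP; destruct HP as [e He].
  assert (HK1 : 0 < Rabs K + 1) by (pose proof (Rabs_pos K); lra).
  (* d validates the quotient estimate, 1/4 the two expansions, and the last bound makes K t < e. *)
  assert (Hm : 0 < Rmin (Rmin d (1 / 4)) (e / (Rabs K + 1))).
  { repeat apply Rmin_glb_lt; try lra.
    apply Rdiv_lt_0_compat; [apply cond_pos|assumption]. }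
  exists (mkposreal _ Hm); intros t Ht Ht0; apply He.
  assert (Ht' : Rabs (t - 0) < Rmin (Rmin d (1 / 4)) (e / (Rabs K + 1))) by exact Ht.
  rewrite Rminus_0_r, Rabs_pos_eq in Ht' by lra.
  pose proof (Rmin_l (Rmin d (1 / 4)) (e / (Rabs K + 1))).
  pose proof (Rmin_r (Rmin d (1 / 4)) (e / (Rabs K + 1))).
  pose proof (Rmin_l d (1 / 4)); pose proof (Rmin_r d (1 / 4)).
  destruct (HG t) as [l [Hl Hl']]; [rewrite Rabs_pos_eq; lra|].
  destruct (HJ t ltac:(lra)) as [J [HJ1 HJ2]].
  destruct (HK t l J ltac:(lra) HJ1 Hl') as [Hl0 HKt].
  (* Since t > 0, the point 1 + t lies in the half-plane where the continuation is given by the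
     integral. *)
  rewrite <- RtoC_plus, Hint by (simpl; lra).
  rewrite (zeta_int_real m t l _ HJ2 Hl).
  rewrite <- RtoC_inv, <- RtoC_mult, <- RtoC_minus by lra.
  rewrite <- RtoC_div by lra.
  rewrite <- !RtoC_minus, Cmod_R.
  rewrite Rplus_minus_l.
  eapply Rle_lt_trans; [exact HKt|].
  assert (H3 : t < e / (Rabs K + 1)) by lra.
  apply Rmult_lt_compat_r with (r := Rabs K + 1) in H3; [|assumption].
  replace (e / (Rabs K + 1) * (Rabs K + 1)) with (pos e) in H3 by (field; lra).
  pose proof (Rle_abs K); nra.
Qed.
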